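(* Let $R$ be a commutative ring, let $\sigma$ be an automorphism of $R$ such that for every $\mathfrak{m}\in\operatorname{Max}(R)$ and every $s\in R$, if $s\notin\mathfrak{m}$ then $\sigma(s)\notin\mathfrak{m}$, and let $A:=R[x_1,\dots,x_n;\sigma]$. Let $F(X)\in M_{r\times s}(A)$. Then $F(X)$ is equivalent to $F(0)$ over $A$ if and only if, for every $\mathfrak{m}\in\operatorname{Max}(R)$, the image $\overline{F(X)}$ of $F(X)$ in $M_{r\times s}(A_{\mathfrak{m}})$ is equivalent over $A_{\mathfrak{m}}$ to the image $\overline{F(0)}$ of $F(0)$.
   Context: $A=R[x_1,\dots,x_n;\sigma]$ denotes the Ore extension of $R$ in variables $x_1,\dots,x_n$ with $x_ix_j=x_jx_i$ and $x_ir=\sigma(r)x_i$ for all $i,j$ and all $r\in R$; it is a free left $R$-module on the monomials $x_1^{\alpha_1}\cdots x_n^{\alpha_n}$. $F(0)$ is the matrix over $R$ obtained from $F(X)$ by replacing all variables by $0$ (i.e. taking the constant term of each entry, written with coefficients on the left). $\operatorname{Max}(R)$ is the set of maximal ideals of $R$. For $\mathfrak{m}\in\operatorname{Max}(R)$, $A_{\mathfrak{m}}:=S^{-1}A\cong R_{\mathfrak{m}}[x_1,\dots,x_n;\overline{\sigma}]$ with $S=R\setminus\mathfrak{m}$ and $\overline{\sigma}(r/s)=\sigma(r)/\sigma(s)$ (well defined by the hypothesis on $\sigma$), with the same commutation rules for the variables; images are taken under the canonical map $A\to A_{\mathfrak{m}}$. Two $r\times s$ matrices $F,G$ over a ring $B$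 are equivalent over $B$ if $F=PGQ$ with $P\in GL_r(B)$ and $Q\in GL_s(B)$. *)

(* Defs.v *)
From HB Require Import structures.
From mathcomp Require Import all_boot all_order all_algebra finmap ring.
From mathcomp Require Import boolp.
From mathcomp Require Import monalg.

Set Implicit Arguments.
Unset Strict Implicit.
Unset Printing Implicit Defensive.

Import GRing.Theory.
Local Open Scope ring_scope.
Local Open Scope quotient_scope.

Local Notation "1" := (@mone _) : monom_scope.
Local Notation "x * y" := (mmul x y) : monom_scope.

(* R ranges over comPzRingType, so that the zero ring is allowed. The library's
   idealr_closed excludes it and also has properness built in. *)
Section MaximalIdeals.
Variable R : comPzRingType.

Definition ideal_closed (I : {pred R}) : Prop :=
  [/\ 0 \in I, forall a b : R, a \in I -> b \in I -> a + b \in I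
    & forall a b : R, b \in I -> a * b \in I].

Definition maximal_closed (m : {pred R}) : Prop :=
  [/\ ideal_closed m, exists a : R, a \notin m
    & forall J : {pred R}, ideal_closed J -> {subset m <= J} ->
        {subset J <= m} \/ forall a : R, a \in J].

Record maxIdeal := MaxIdeal {
  max_pred :> {pred R};
  maxIdealP : maximal_closed max_pred
}.

Lemma maxIdeal_compl_closed (m : maxIdeal) :
  GRing.mulr_closed [predC max_pred m].
Proof.
case: m => m [[m0 mD mM] [c cm] mmax] /=.
have m1 : 1 \notin m.
  by apply: contra cm => m1; rewrite -[c]mulr1; apply: mM.
split=> [//|a b]; rewrite !inE => am bm; apply/negP => abm.
pose J : {pred R} :=
  [pred x : R | `[< exists y z : R, z \in m /\ x = y * a + z >]].
have JI : ideal_closed J.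
  split.
  - by apply/asboolP; exists 0, 0; rewrite mul0r addr0.
  - move=> x x' /asboolP[y [z [zm ->]]] /asboolP[y' [z' [zm' ->]]].
    apply/asboolP; exists (y + y'), (z + z'); split; first exact: mD.
    by rewrite mulrDl addrACA.
  - move=> x x' /asboolP[y [z [zm ->]]].
    apply/asboolP; exists (x * y), (x * z); split; first exact: mM.
    by rewrite mulrDr mulrA.
have mJ : {subset m <= J}.
  by move=> z zm; apply/asboolP; exists 0, z; rewrite mul0r add0r.
have aJ : a \in J.
  by apply/asboolP; exists 1, 0; rewrite mul1r addr0.
case: (mmax J JI mJ) => [Jm|allJ]; first by rewrite Jm in am.
have /asboolP[y [z [zm e]]] := allJ 1.
suff : b \in m by apply/negP.
rewrite -[b]mul1r e mulrDl -mulrA; apply: mD; first exact: mM.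
by rewrite mulrC; apply: mM.
Qed.

End MaximalIdeals.

(* The localization of R at a multiplicative set S: pairs (a, s) with s in S,
   where (a, s) ~ (b, t) iff u (a t) = u (b s) for some u in S. *)
Section Localization.
Variables (R : comPzRingType) (S : {pred R}) (hS : GRing.mulr_closed S).

Definition preloc of GRing.mulr_closed S := (R * {s : R | s \in S})%type.
HB.instance Definition _ := Choice.on (preloc hS).

Implicit Types x y z : preloc hS.
Local Notation num x := (x.1).
Local Notation den x := (val x.2).

Definition loc_rel x y : bool :=
  `[< exists u, u \in S /\ u * (num x * den y) = u * (num y * den x) >].

Lemma loc_refl : reflexive loc_rel.
Proof. by move=> x; apply/asboolP; exists 1; case: hS. Qed.

Lemma loc_sym : symmetric loc_rel.
Proof.
by move=> x y; apply/asboolP/asboolP => -[u [uS e]]; exists u; rewrite e.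
Qed.

Lemma loc_trans : transitive loc_rel.
Proof.
move=> y x z /asboolP[u [uS e]] /asboolP[v [vS f]]; apply/asboolP.
exists (u * v * den y); split.
  by apply: hS.2 (valP _); apply: hS.2.
ring: e f.
Qed.

Canonical loc_equiv := EquivRel loc_rel loc_refl loc_sym loc_trans.

Definition localization := {eq_quot loc_rel}.
HB.instance Definition _ : EqQuotient _ loc_rel localization :=
  EqQuotient.on localization.
HB.instance Definition _ := Choice.on localization.

Lemma loc_eq x y :
  \pi_localization x = \pi y <->
  exists u, u \in S /\ u * (num x * den y) = u * (num y * den x).
Proof.
split=> [/eqmodP/= /asboolP //|h].
by apply/eqmodP/asboolP.
Qed.

Definition loc_one : {s : R | s \in S} := exist _ 1 hS.1.
Definition loc_den (s t : {s : R | s \in S}) : {s : R | s \in S} :=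
  exist _ (val s * val t) (hS.2 _ _ (valP s) (valP t)).

Definition loc_add x y : preloc hS :=
  (num x * den y + num y * den x, loc_den x.2 y.2).
Definition loc_opp x : preloc hS := (- num x, x.2).
Definition loc_mul x y : preloc hS := (num x * num y, loc_den x.2 y.2).

Definition locD := lift_op2 localization loc_add.
Definition locN := lift_op1 localization loc_opp.
Definition locM := lift_op2 localization loc_mul.
Definition loc0 : localization := \pi_localization (0, loc_one).
Definition loc1 : localization := \pi_localization (1, loc_one).

Lemma pi_locD : {morph \pi : x y / loc_add x y >-> locD x y}.
Proof.
move=> x y; unlock locD; apply/loc_eq.
have /loc_eq[u [uS e]] := esym (reprK (\pi_localization x)).
have /loc_eq[v [vS f]] := esym (reprK (\pi_localization y)).
exists (u * v); split; first exact: hS.2.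
move: e f => /= e f.  ring: e f.
Qed.
Canonical pi_locD_morph := PiMorph2 pi_locD.

Lemma pi_locN : {morph \pi : x / loc_opp x >-> locN x}.
Proof.
move=> x; unlock locN; apply/loc_eq.
have /loc_eq[u [uS e]] := esym (reprK (\pi_localization x)).
exists u; split=> //; move: e => /= e; ring: e.
Qed.
Canonical pi_locN_morph := PiMorph1 pi_locN.

Lemma pi_locM : {morph \pi : x y / loc_mul x y >-> locM x y}.
Proof.
move=> x y; unlock locM; apply/loc_eq.
have /loc_eq[u [uS e]] := esym (reprK (\pi_localization x)).
have /loc_eq[v [vS f]] := esym (reprK (\pi_localization y)).
exists (u * v); split; first exact: hS.2.
move: e f => /= e f; ring: e f.
Qed.
Canonical pi_locM_morph := PiMorph2 pi_locM.

Lemma loc_eqW x y :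
  num x * den y = num y * den x -> \pi_localization x = \pi y.
Proof. by move=> e; apply/loc_eq; exists 1; split; [exact: hS.1|rewrite e]. Qed.

Lemma locDA : associative locD.
Proof.
elim/quotW=> x; elim/quotW=> y; elim/quotW=> z; rewrite -!pi_locD.
apply: loc_eqW => /=; ring.
Qed.

Lemma locDC : commutative locD.
Proof.
elim/quotW=> x; elim/quotW=> y; rewrite -!pi_locD.
apply: loc_eqW => /=; ring.
Qed.

Lemma loc0D : left_id loc0 locD.
Proof.
by elim/quotW=> x; rewrite -pi_locD; apply: loc_eqW => /=; ring.
Qed.

Lemma locND : left_inverse loc0 locN locD.
Proof.
by elim/quotW=> x; rewrite -pi_locN -pi_locD; apply: loc_eqW => /=; ring.
Qed.

HB.instance Definition _ :=
  GRing.isZmodule.Build localization locDA locDC loc0D locND.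

Lemma locMA : associative locM.
Proof.
elim/quotW=> x; elim/quotW=> y; elim/quotW=> z; rewrite -!pi_locM.
apply: loc_eqW => /=; ring.
Qed.

Lemma locMC : commutative locM.
Proof.
elim/quotW=> x; elim/quotW=> y; rewrite -!pi_locM.
apply: loc_eqW => /=; ring.
Qed.

Lemma loc1M : left_id loc1 locM.
Proof.
by elim/quotW=> x; rewrite -pi_locM; apply: loc_eqW => /=; ring.
Qed.

Lemma locMD : left_distributive locM locD.
Proof.
elim/quotW=> x; elim/quotW=> y; elim/quotW=> z.
rewrite -!(pi_locM, pi_locD).
apply: loc_eqW => /=; ring.
Qed.

HB.instance Definition _ :=
  GRing.Zmodule_isComPzRing.Build localization locMA locMC loc1M locMD.

Lemma locBE (p q : localization) : p - q = locD p (locN q).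
Proof. by []. Qed.

Lemma locME (p q : localization) : p * q = locM p q.
Proof. by []. Qed.

Definition to_loc (a : R) : localization := \pi_localization (a, loc_one).

Lemma to_loc_is_zmod_morphism : zmod_morphism to_loc.
Proof.
by move=> a b; rewrite locBE -pi_locN -pi_locD; apply: loc_eqW => /=; ring.
Qed.

Lemma to_loc_is_monoid_morphism : monoid_morphism to_loc.
Proof.
by split=> [//|a b]; rewrite locME -pi_locM; apply: loc_eqW => /=; ring.
Qed.

HB.instance Definition _ :=
  GRing.isZmodMorphism.Build R localization to_loc to_loc_is_zmod_morphism.
HB.instance Definition _ :=
  GRing.isMonoidMorphism.Build R localization to_loc to_loc_is_monoid_morphism.

End Localization.

(* The endomorphism a / s |-> f a / f s that f induces when f(S) <= S. *)
Section LocalizedMorphism.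
Variables (R : comPzRingType) (S : {pred R}) (hS : GRing.mulr_closed S).
Variable f : {rmorphism R -> R}.
Hypothesis fS : forall s, s \in S -> f s \in S.

Definition preloc_map (x : preloc hS) : preloc hS :=
  (f x.1, exist _ (f (val x.2)) (fS (valP x.2))).

Definition loc_map := lift_op1 (localization hS) preloc_map.

Lemma pi_loc_map : {morph \pi : x / preloc_map x >-> loc_map x}.
Proof.
move=> x; unlock loc_map; apply/loc_eq.
have /loc_eq[u [uS e]] := esym (reprK (\pi_(localization hS) x)).
exists (f u); split; first exact: fS.
by rewrite /= -!rmorphM e.
Qed.

Lemma loc_map_is_zmod_morphism : zmod_morphism loc_map.
Proof.
elim/quotW=> x; elim/quotW=> y; rewrite !locBE.
rewrite -!(pi_loc_map, pi_locN, pi_locD).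
by apply: loc_eqW; rewrite /= !(rmorphM, rmorphD, rmorphN).
Qed.

Lemma loc_map_is_monoid_morphism : monoid_morphism loc_map.
Proof.
split; first by rewrite -pi_loc_map; apply: loc_eqW; rewrite /= !rmorph1.
elim/quotW=> x; elim/quotW=> y; rewrite !locME.
rewrite -!(pi_loc_map, pi_locM).
by apply: loc_eqW; rewrite /= !rmorphM.
Qed.

HB.instance Definition _ :=
  GRing.isZmodMorphism.Build (localization hS) (localization hS) loc_map
    loc_map_is_zmod_morphism.
HB.instance Definition _ :=
  GRing.isMonoidMorphism.Build (localization hS) (localization hS) loc_map
    loc_map_is_monoid_morphism.

End LocalizedMorphism.
Arguments loc_map {R S} hS {f} fS.

(* R[x_1, ..., x_n; sigma]: finitely supported families of (left) coefficients
   indexed by monomials; moving a coefficient b to the left of the monomial k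
   turns it into sigma^|k| b, where |k| is the total degree. *)
Record ore (n : nat) (R : comPzRingType) (sigma : {rmorphism R -> R}) :=
  Ore { ore_val :> {malg R['X_{1..n}]} }.

HB.instance Definition _ (n : nat) (R : comPzRingType)
  (sigma : {rmorphism R -> R}) := [isNew for @ore_val n R sigma].
HB.instance Definition _ (n : nat) (R : comPzRingType)
  (sigma : {rmorphism R -> R}) := [Choice of ore n sigma by <:].

HB.lock Definition ore_zero (n : nat) (R : comPzRingType)
  (sigma : {rmorphism R -> R}) : ore n sigma := Ore sigma 0.
HB.lock Definition ore_opp (n : nat) (R : comPzRingType)
  (sigma : {rmorphism R -> R}) (p : ore n sigma) : ore n sigma :=
  Ore sigma (- ore_val p).
HB.lock Definition ore_add (n : nat) (R : comPzRingType)
  (sigma : {rmorphism R -> R}) (p q : ore n sigma) : ore n sigma :=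
  Ore sigma (ore_val p + ore_val q).

(* The monomial a x^k. *)
HB.lock Definition oreU (n : nat) (R : comPzRingType)
  (sigma : {rmorphism R -> R}) (a : R) (k : 'X_{1..n}) : ore n sigma :=
  Ore sigma << a *g k >>.
Arguments oreU {n R} sigma a k.

Section OreZmodule.
Variables (n : nat) (R : comPzRingType) (sigma : {rmorphism R -> R}).
Implicit Types (p q : ore n sigma) (k l : 'X_{1..n}) (a b : R).

Lemma oreP p q : (forall k, p@_k = q@_k) -> p = q.
Proof. by case: p q => [p] [q] /= pq; congr Ore; apply/malgP. Qed.

Lemma ore_zeroE k : (@ore_zero n R sigma)@_k = 0.
Proof. by rewrite unlock /= mcoeff0. Qed.

Lemma ore_oppE p k : (@ore_opp n R sigma p)@_k = - p@_k.
Proof. by rewrite unlock /= mcoeffN. Qed.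

Lemma ore_addE p q k : (@ore_add n R sigma p q)@_k = p@_k + q@_k.
Proof. by rewrite unlock /= mcoeffD. Qed.

Lemma oreUE a k l : (oreU sigma a k)@_l = a *+ (k == l).
Proof. by rewrite unlock /= mcoeffU. Qed.

Lemma ore_addA : associative (@ore_add n R sigma).
Proof. by move=> p q r; apply: oreP => k; rewrite !ore_addE addrA. Qed.

Lemma ore_addC : commutative (@ore_add n R sigma).
Proof. by move=> p q; apply: oreP => k; rewrite !ore_addE addrC. Qed.

Lemma ore_add0l : left_id (@ore_zero n R sigma) (@ore_add n R sigma).
Proof. by move=> p; apply: oreP => k; rewrite ore_addE ore_zeroE add0r. Qed.

Lemma ore_addNl :
  left_inverse (@ore_zero n R sigma) (@ore_opp n R sigma) (@ore_add n R sigma).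
Proof.
by move=> p; apply: oreP => k; rewrite ore_addE ore_oppE ore_zeroE addNr.
Qed.

HB.instance Definition _ := GRing.isZmodule.Build (ore n sigma)
  ore_addA ore_addC ore_add0l ore_addNl.

Lemma ore_coef0 k : (0 : ore n sigma)@_k = 0.
Proof. exact: ore_zeroE. Qed.

Lemma ore_coefD p q k : (p + q)@_k = p@_k + q@_k.
Proof. exact: ore_addE. Qed.

Lemma ore_coefB p q k : (p - q)@_k = p@_k - q@_k.
Proof. by rewrite ore_coefD ore_oppE. Qed.

Lemma ore_coef_sum (I : Type) (r : seq I) (P : pred I) (F : I -> ore n sigma) k :
  (\sum_(i <- r | P i) F i)@_k = \sum_(i <- r | P i) (F i)@_k.
Proof.
exact: (big_morph (fun p => p@_k) (fun p q => ore_coefD p q k) (ore_coef0 k)).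
Qed.

Lemma oreU0 k : oreU sigma 0 k = 0.
Proof. by apply: oreP => l; rewrite ore_coef0 oreUE mul0rn. Qed.

Lemma oreUD a b k : oreU sigma (a + b) k = oreU sigma a k + oreU sigma b k.
Proof. by apply: oreP => l; rewrite ore_coefD !oreUE mulrnDl. Qed.

Lemma oreUB a b k : oreU sigma (a - b) k = oreU sigma a k - oreU sigma b k.
Proof. by apply: oreP => l; rewrite ore_coefB !oreUE mulrnBl. Qed.

Lemma ore_sumU p : p = \sum_(k <- msupp p) oreU sigma p@_k k.
Proof.
apply: oreP => l; rewrite ore_coef_sum {1}(monalgE p) raddf_sum /=.
by apply: eq_bigr => k _; rewrite oreUE mcoeffU.
Qed.

Lemma ore_ind (P : ore n sigma -> Prop) :
  P 0 -> (forall p q, P p -> P q -> P (p + q)) ->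
  (forall a k, P (oreU sigma a k)) -> forall p, P p.
Proof.
move=> P0 PD PU p; rewrite (ore_sumU p).
by apply: big_ind => // k _; apply: PU.
Qed.

Lemma msupp_oreD p q : (msupp (p + q)%R `<=` msupp p `|` msupp q)%fset.
Proof.
apply/fsubsetP => k; rewrite in_fsetU -!mcoeff_neq0 ore_coefD.
by case: (eqVneq p@_k 0) => //= ->; rewrite add0r.
Qed.

End OreZmodule.

Section Twist.
Variables (n : nat) (R : comPzRingType) (sigma : {rmorphism R -> R}).

Definition twist (k : 'X_{1..n}) (a : R) : R := iter (mdeg k) sigma a.

Lemma twist_is_zmod_morphism k : zmod_morphism (twist k).
Proof.
rewrite /twist => a b; elim: (mdeg k) => //= d ->; exact: rmorphB.
Qed.

Lemma twist_is_monoid_morphism k : monoid_morphism (twist k).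
Proof.
rewrite /twist; split=> [|a b]; elim: (mdeg k) => //= d ->;
  [exact: rmorph1 | exact: rmorphM].
Qed.

HB.instance Definition _ k :=
  GRing.isZmodMorphism.Build R R (twist k) (twist_is_zmod_morphism k).
HB.instance Definition _ k :=
  GRing.isMonoidMorphism.Build R R (twist k) (twist_is_monoid_morphism k).

Lemma twist1 a : twist 1%M a = a.
Proof. by rewrite /twist mdeg1. Qed.

Lemma twistU i a : twist (ucm i) a = sigma a.
Proof. by rewrite /twist mdegU. Qed.

Lemma twistM k l a : twist (k * l)%M a = twist k (twist l a).
Proof. by rewrite /twist mdegM iterD. Qed.

End Twist.

HB.lock Definition ore_mul (n : nat) (R : comPzRingType)
    (sigma : {rmorphism R -> R}) (p q : ore n sigma) : ore n sigma :=
  \sum_(k <- msupp p) \sum_(l <- msupp q)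
    oreU sigma (p@_k * twist sigma k q@_l) (k * l)%M.

Section OreRing.
Variables (n : nat) (R : comPzRingType) (sigma : {rmorphism R -> R}).

Local Notation ore := (ore n sigma).
Local Notation oreU := (oreU sigma).
Local Notation ore_mul := (@ore_mul n R sigma).
Implicit Types (p q : ore) (k l : 'X_{1..n}) (a b : R).

Definition oreC a : ore := oreU a 1%M.
Definition oreX (i : 'I_n) : ore := oreU 1%R (ucm i).

Lemma ore_mulEw (d1 d2 : {fset 'X_{1..n}}) p q :
  (msupp p `<=` d1)%fset -> (msupp q `<=` d2)%fset ->
  ore_mul p q = \sum_(k <- d1) \sum_(l <- d2)
    oreU (p@_k * twist sigma k q@_l) (k * l)%M.
Proof.
move=> le1 le2; rewrite ore_mul.unlock (big_fset_incl _ le1) /=; last first.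
  move=> k _ /mcoeff_outdom pk.
  by rewrite big1 // => l _; rewrite pk mul0r oreU0.
apply/eq_bigr=> k _; apply/big_fset_incl => // l _ /mcoeff_outdom ->.
by rewrite rmorph0 mulr0 oreU0.
Qed.

Lemma ore_mulDl : left_distributive ore_mul +%R.
Proof.
move=> p1 p2 q; pose d := (msupp p1 `|` msupp p2)%fset.
rewrite (@ore_mulEw d (msupp q)) ?msupp_oreD //.
rewrite (@ore_mulEw d (msupp q) p1) ?fsubsetUl //.
rewrite (@ore_mulEw d (msupp q) p2) ?fsubsetUr //.
rewrite -big_split /=; apply/eq_bigr=> k _.
rewrite -big_split /=; apply/eq_bigr=> l _.
by rewrite ore_coefD mulrDl oreUD.
Qed.

Lemma ore_mulDr : right_distributive ore_mul +%R.
Proof.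
move=> p q1 q2; pose d := (msupp q1 `|` msupp q2)%fset.
rewrite (@ore_mulEw (msupp p) d) ?msupp_oreD //.
rewrite (@ore_mulEw (msupp p) d p q1) ?fsubsetUl //.
rewrite (@ore_mulEw (msupp p) d p q2) ?fsubsetUr //.
rewrite -big_split /=; apply/eq_bigr=> k _.
rewrite -big_split /=; apply/eq_bigr=> l _.
by rewrite ore_coefD rmorphD mulrDr oreUD.
Qed.

Lemma ore_mul0l : left_zero 0 ore_mul.
Proof.
move=> q; rewrite (ore_mulEw (fsubset_refl _) (fsubset_refl _)).
by apply: big1 => k _; apply: big1 => l _; rewrite ore_coef0 mul0r oreU0.
Qed.

Lemma ore_mul0r : right_zero 0 ore_mul.
Proof.
move=> q; rewrite (ore_mulEw (fsubset_refl _) (fsubset_refl _)).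
apply: big1 => k _; apply: big1 => l _.
by rewrite ore_coef0 rmorph0 mulr0 oreU0.
Qed.

Lemma msupp_oreU_le a k : (msupp (oreU a k) `<=` [fset k])%fset.
Proof. by rewrite oreU.unlock; apply: msuppU_le. Qed.

Lemma ore_mulUU a b k l :
  ore_mul (oreU a k) (oreU b l) = oreU (a * twist sigma k b) (k * l)%M.
Proof.
rewrite (ore_mulEw (msupp_oreU_le _ _) (msupp_oreU_le _ _)).
by rewrite !big_seq_fset1 !oreUE !eqxx.
Qed.

Lemma ore_mulA : associative ore_mul.
Proof.
move=> p q r; elim/ore_ind: p => [|p p' ep ep'|a k].
- by rewrite !ore_mul0l.
- by rewrite !ore_mulDl ep ep'.
elim/ore_ind: q => [|q q' eq eq'|b l].
- by rewrite !(ore_mul0l, ore_mul0r).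
- by rewrite !(ore_mulDl, ore_mulDr); rewrite eq eq'.
elim/ore_ind: r => [|r r' er er'|c m].
- by rewrite !ore_mul0r.
- by rewrite !ore_mulDr; rewrite er er'.
rewrite !ore_mulUU; congr oreU; last exact: mulmA.
by rewrite twistM rmorphM mulrA.
Qed.

Lemma ore_mul1l : left_id (oreC 1) ore_mul.
Proof.
elim/ore_ind => [|p q ep eq|a k]; first exact: ore_mul0r.
  by rewrite ore_mulDr ep eq.
by rewrite ore_mulUU twist1 mul1r mul1m.
Qed.

Lemma ore_mul1r : right_id (oreC 1) ore_mul.
Proof.
elim/ore_ind => [|p q ep eq|a k]; first exact: ore_mul0l.
  by rewrite ore_mulDl ep eq.
by rewrite ore_mulUU rmorph1 mulr1 mulm1.
Qed.

HB.instance Definition _ := GRing.Zmodule_isPzRing.Build (ore)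
  ore_mulA ore_mul1l ore_mul1r ore_mulDl ore_mulDr.

Lemma oreUU a b k l :
  oreU a k * oreU b l = oreU (a * twist sigma k b) (k * l)%M.
Proof. exact: ore_mulUU. Qed.

Lemma oreC_is_zmod_morphism : zmod_morphism oreC.
Proof. by move=> a b; rewrite /oreC oreUB. Qed.

Lemma oreC_is_monoid_morphism : monoid_morphism oreC.
Proof. by split=> // a b; rewrite /oreC oreUU twist1 mulm1. Qed.

HB.instance Definition _ :=
  GRing.isZmodMorphism.Build R (ore) oreC oreC_is_zmod_morphism.
HB.instance Definition _ :=
  GRing.isMonoidMorphism.Build R (ore) oreC oreC_is_monoid_morphism.

Lemma oreXX i j : oreX i * oreX j = oreX j * oreX i.
Proof. by rewrite /oreX !oreUU !twistU !rmorph1 mulmC. Qed.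

Lemma oreXC i a : oreX i * oreC a = oreC (sigma a) * oreX i.
Proof.
by rewrite /oreX /oreC !oreUU twistU twist1 mulr1 mul1r mulm1 mul1m.
Qed.

Lemma ore_monomialM (I : Type) (s : seq I) (f : I -> 'X_{1..n}) :
  \prod_(i <- s) oreU 1%R (f i) =
  oreU 1%R (\big[mmul/1%M]_(i <- s) f i).
Proof.
elim: s => [|i s IHs]; first by rewrite !big_nil.
by rewrite !big_cons IHs oreUU rmorph1 mulr1.
Qed.

Lemma ore_monomial k :
  oreU 1%R k = \prod_(i < n) oreX i ^+ k i.
Proof.
have cmS (I : Type) (s : seq I) (f : I -> 'X_{1..n}) (j : 'I_n) :
    (\big[mmul/1%M]_(i <- s) f i) j = (\sum_(i <- s) f i j)%N.
  by elim: s => [|i s IHs]; rewrite ?big_nil ?cm1 // !big_cons cmM IHs.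
pose f i := \big[mmul/1%M]_(x <- iota 0 (k i)) ucm i.
transitivity (\prod_(i < n) oreU 1%R (f i)).
  rewrite ore_monomialM; congr oreU; apply/eqP/cmP => j.
  rewrite cmS (bigD1 j) //= big1 ?addn0 => [|i /negbTE ij]; rewrite cmS.
    by under eq_bigr do rewrite cmUU; rewrite sum1_size size_iota.
  by rewrite big1 // => _ _; rewrite cmU ij.
apply: eq_bigr => i _; rewrite -ore_monomialM.
by rewrite big_const_seq count_predT size_iota -Monoid.iteropE.
Qed.

Lemma oreE p : p = \sum_(k <- msupp p) oreC p@_k * \prod_(i < n) oreX i ^+ k i.
Proof.
rewrite {1}(ore_sumU p); apply: eq_bigr => k _.
by rewrite -ore_monomial /oreC oreUU twist1 mulr1 mul1m.
Qed.

End OreRing.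

Definition ore_map (n : nat) (R R' : comPzRingType)
    (sigma : {rmorphism R -> R}) (tau : {rmorphism R' -> R'})
    (f : {rmorphism R -> R'}) (p : ore n sigma) : ore n tau :=
  \sum_(k <- msupp p) oreU tau (f p@_k) k.

Section OreMap.
Variables (n : nat) (R R' : comPzRingType).
Variables (sigma : {rmorphism R -> R}) (tau : {rmorphism R' -> R'}).
Variable f : {rmorphism R -> R'}.
Implicit Types p q : ore n sigma.

Lemma ore_mapE p k : (ore_map tau f p)@_k = f p@_k.
Proof.
rewrite /ore_map ore_coef_sum [in RHS](ore_sumU p) ore_coef_sum rmorph_sum.
by apply: eq_bigr => l _; rewrite !oreUE rmorphMn.
Qed.

Lemma ore_mapB : {morph @ore_map n R R' sigma tau f : p q / p - q}.
Proof.
move=> p q; apply: oreP => k.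
by rewrite ore_coefB !ore_mapE ore_coefB rmorphB.
Qed.

Lemma ore_mapU a (k : 'X_{1..n}) :
  ore_map tau f (oreU sigma a k) = oreU tau (f a) k.
Proof. by apply: oreP => l; rewrite ore_mapE !oreUE rmorphMn. Qed.

Lemma ore_map1 : ore_map tau f (1 : ore n sigma) = 1.
Proof. by rewrite [LHS]ore_mapU rmorph1. Qed.

Lemma ore_mapM (f_sigma : forall a, f (sigma a) = tau (f a)) :
  {morph @ore_map n R R' sigma tau f : p q / p * q}.
Proof.
have fB p q : ore_map tau f (p + q) = ore_map tau f p + ore_map tau f q.
  by apply: oreP => k; rewrite ore_coefD !ore_mapE ore_coefD rmorphD.
have f0 : ore_map tau f (0 : ore n sigma) = 0.
  by apply: oreP => k; rewrite ore_mapE !ore_coef0 rmorph0.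
move=> p q; elim/ore_ind: p => [|p p' ep ep'|a k].
- by rewrite f0 !mul0r f0.
- by rewrite fB !mulrDl fB ep ep'.
elim/ore_ind: q => [|q q' eq eq'|b l].
- by rewrite f0 !mulr0 f0.
- by rewrite fB !mulrDr fB eq eq'.
rewrite oreUU !ore_mapU oreUU rmorphM; congr (oreU _ (_ * _) _).
by rewrite /twist; elim: (mdeg k) => //= d <-.
Qed.

End OreMap.

(* ore_loc : R[X; sigma] -> (S^-1 R)[X; sigma_S] is the canonical map of
   R[X; sigma] to its left ring of fractions with respect to S, by ore_loc_unit,
   ore_loc_frac and ore_loc_eq0. *)
Section OreLocalization.
Variables (n : nat) (R : comPzRingType) (S : {pred R}).
Variables (hS : GRing.mulr_closed S) (sigma : {rmorphism R -> R}).
Variable sigmaS : forall s, s \in S -> sigma s \in S.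

Definition ore_loc : ore n sigma -> ore n (loc_map hS sigmaS) :=
  ore_map (loc_map hS sigmaS) (to_loc hS).

Lemma loc_map_to_loc a :
  to_loc hS (sigma a) = loc_map hS sigmaS (to_loc hS a).
Proof. by rewrite -pi_loc_map; apply: loc_eqW; rewrite /= rmorph1. Qed.

Lemma ore_loc_is_zmod_morphism : zmod_morphism ore_loc.
Proof. exact: ore_mapB. Qed.

Lemma ore_loc_is_monoid_morphism : monoid_morphism ore_loc.
Proof.
split; [exact: ore_map1 | exact: ore_mapM loc_map_to_loc].
Qed.

HB.instance Definition _ := GRing.isZmodMorphism.Build
  (ore n sigma) (ore n (loc_map hS sigmaS)) ore_loc ore_loc_is_zmod_morphism.
HB.instance Definition _ := GRing.isMonoidMorphism.Build
  (ore n sigma) (ore n (loc_map hS sigmaS)) ore_loc ore_loc_is_monoid_morphism.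

Lemma to_loc_eq0 a : to_loc hS a = 0 <-> exists u, u \in S /\ u * a = 0.
Proof.
split=> [/loc_eq[u [uS]]|[u [uS e]]].
  by rewrite /= !(mulr1, mul0r, mulr0); exists u.
by apply/loc_eq; exists u; rewrite /= mulr1 mul0r mulr0.
Qed.

Lemma ore_locC a :
  ore_loc (oreC n sigma a) = oreC n (loc_map hS sigmaS) (to_loc hS a).
Proof. exact: ore_mapU. Qed.

Lemma ore_loc_unit s : s \in S ->
  exists q, ore_loc (oreC n sigma s) * q = 1 /\ q * ore_loc (oreC n sigma s) = 1.
Proof.
move=> sS; pose t : localization hS := \pi_(localization hS) (1, exist _ s sS).
have st : to_loc hS s * t = 1.
  by rewrite locME -pi_locM; apply: loc_eqW => /=; ring.
exists (oreC n (loc_map hS sigmaS) t); rewrite ore_locC.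
split; first by rewrite -(rmorphM (oreC n (loc_map hS sigmaS))) st rmorph1.
by rewrite -(rmorphM (oreC n (loc_map hS sigmaS))) mulrC st rmorph1.
Qed.

Lemma ore_loc_eq0 p :
  ore_loc p = 0 <-> exists s, s \in S /\ oreC n sigma s * p = 0.
Proof.
split=> [p0|[s [sS e]]]; last first.
  have [q [_ qs]] := ore_loc_unit sS.
  by rewrite -[ore_loc p]mul1r -qs -mulrA -rmorphM e rmorph0 mulr0.
have pk k : exists u, u \in S /\ u * p@_k = 0.
  apply: (to_loc_eq0 p@_k).1.
  have <- : (ore_loc p)@_k = to_loc hS p@_k by exact: ore_mapE.
  by rewrite p0 ore_coef0.
have ps (r : seq 'X_{1..n}) :
    exists u, u \in S /\ forall k, k \in r -> u * p@_k = 0.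
  elim: r => [|k r [u [uS us]]].
    by exists 1; split=> [|k]; [exact: hS.1 | rewrite in_nil].
  have [v [vS vk]] := pk k; exists (u * v); split; first exact: hS.2.
  move=> l; rewrite inE => /orP[/eqP->|/us e]; first by rewrite -mulrA vk mulr0.
  by rewrite mulrAC e mul0r.
have [u [uS up]] := ps (enum_fset (msupp p)).
exists u; split=> //; rewrite (ore_sumU p) mulr_sumr big_seq big1 // => k /up e.
by rewrite /oreC oreUU twist1 e oreU0.
Qed.

Lemma ore_loc_frac q :
  exists s p, s \in S /\ ore_loc (oreC n sigma s) * q = ore_loc p.
Proof.
elim/ore_ind: q => [|q q' [s [p [sS e]]] [s' [p' [sS' e']]]|a k].
- by exists 1, 0; rewrite mulr0 rmorph0; split; first exact: hS.1.
- exists (s * s'), (oreC n sigma s' * p + oreC n sigma s * p').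
  split; first exact: hS.2.
  have E1 : ore_loc (oreC n sigma (s * s')) =
      ore_loc (oreC n sigma s) * ore_loc (oreC n sigma s').
    by rewrite -(rmorphM ore_loc) -(rmorphM (oreC n sigma)).
  have E2 : ore_loc (oreC n sigma (s * s')) =
      ore_loc (oreC n sigma s') * ore_loc (oreC n sigma s).
    by rewrite -(rmorphM ore_loc) -(rmorphM (oreC n sigma)) (mulrC s').
  rewrite (rmorphD ore_loc) !(rmorphM ore_loc).
  by rewrite /= -e -e' mulrDr {1}E2 E1 !mulrA.
elim/quotW: a => -[a [s sS]]; exists s, (oreU sigma a k); split=> //.
rewrite ore_locC [RHS]ore_mapU [LHS]oreUU twist1 mul1m.
congr oreU; rewrite locME -pi_locM.
by apply: loc_eqW => /=; ring.
Qed.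

End OreLocalization.

(* The matrix F(0). *)
Definition mx_const (n : nat) (R : comPzRingType) (sigma : {rmorphism R -> R})
    (r s : nat) (F : 'M[ore n sigma]_(r, s)) : 'M[ore n sigma]_(r, s) :=
  \matrix_(i, j) oreC n sigma (F i j)@_(1%M).

(* The library's unitmx needs commutative coefficients. *)
Definition mx_invertible (B : pzRingType) (r : nat) (P : 'M[B]_r) : Prop :=
  exists P' : 'M[B]_r, P *m P' = 1%:M /\ P' *m P = 1%:M.

Definition mx_equiv (B : pzRingType) (r s : nat) (F G : 'M[B]_(r, s)) : Prop :=
  exists (P : 'M[B]_r) (Q : 'M[B]_s),
    [/\ mx_invertible P, mx_invertible Q & F = P *m G *m Q].

Definition ore_at (n : nat) (R : comPzRingType) (sigma : {rmorphism R -> R})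
    (m : maxIdeal R) (sigma_m : forall a : R, a \notin m -> sigma a \notin m) :
    pzRingType :=
  ore n (loc_map (maxIdeal_compl_closed m) sigma_m).

Definition to_ore_at (n : nat) (R : comPzRingType)
    (sigma : {rmorphism R -> R}) (m : maxIdeal R)
    (sigma_m : forall a : R, a \notin m -> sigma a \notin m) :
    {rmorphism ore n sigma -> ore_at n sigma_m} :=
  ore_loc (maxIdeal_compl_closed m) sigma_m.

(* Main.v *)
(* Quillen patching. For c in R the dilation x_i |-> c x_i extends to a ring
   endomorphism of A; write F(cX) for the image of F. The c such that
   F((a + cw)X) is equivalent to F(aX) for all a, w form an ideal, and the
   theorem says that 1 belongs to it (take a = 0 and w = 1), so it is enough to
   find such a c outside each maximal ideal m.
   If F = P F(0) Q over A_m, then F((y+z)X) = U F(yX) V for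
   U = P((y+z)X) P(yX)^-1 and V = Q(yX)^-1 Q((y+z)X), where y and z are generic:
   sigma acts on R[y_i, z_i] by y_i |-> y_(i+1), z_i |-> z_(i+1), and y = y_0,
   z = z_0. Since U = V = 1 at z = 0, the substitution z |-> v z clears the
   denominators of U and V, and then makes exact the finitely many identities
   that only held after localization, once sigma^i(v) is divisible by a suitable
   element of R \ m for finitely many i. Such a v exists outside m because
   sigma(m) = m. Specializing y_i |-> sigma^i(a), z_i |-> sigma^i(w), with a and
   w arbitrary, gives c = v. *)
Require Import Defs.
From HB Require Import structures.
From mathcomp Require Import all_boot all_order all_algebra finmap ring.
From mathcomp Require Import boolp classical_sets.
From mathcomp Require Import monalg.

Set Implicit Arguments.
Unset Strict Implicit.
Unset Printing Implicit Defensive.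

Import GRing.Theory.
Local Open Scope ring_scope.

Local Notation "1" := (@mone _) : monom_scope.
Local Notation "x * y" := (mmul x y) : monom_scope.

(** * Dilations of Ore extensions *)

Section TwistedPower.
Variables (R : comPzRingType) (sigma : {rmorphism R -> R}).

(** The coefficient in [(c x)^d = twisted_exp c d * x^d]: moving [c] to the left past [x^i] turns it
    into [sigma^i(c)]. *)
Definition twisted_exp (c : R) (d : nat) : R := \prod_(i < d) iter i sigma c.

Lemma twisted_expS c d :
  twisted_exp c d.+1 = twisted_exp c d * iter d sigma c.
Proof. exact: big_ord_recr. Qed.

Lemma iter_rmorphM i : {morph iter i sigma : a b / a * b}.
Proof. by move=> a b; elim: i => //= i ->; rewrite rmorphM. Qed.

Lemma iter_rmorph1 i : iter i sigma 1 = 1.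
Proof. by elim: i => //= i ->; rewrite rmorph1. Qed.

Lemma twisted_exp1 d : twisted_exp 1 d = 1.
Proof. by apply: big1 => i _; rewrite iter_rmorph1. Qed.

Lemma twisted_exp0 d : twisted_exp 0 d = (d == 0%N)%:R.
Proof.
by case: d => [|d]; rewrite /twisted_exp ?big_ord0 // big_ord_recl mul0r.
Qed.

Lemma twisted_expM c e d :
  twisted_exp (c * e) d = twisted_exp c d * twisted_exp e d.
Proof. by rewrite -big_split; apply: eq_bigr => i _; rewrite iter_rmorphM. Qed.

Lemma twisted_expD c d e :
  twisted_exp c (d + e) = twisted_exp c d * iter d sigma (twisted_exp c e).
Proof.
elim: e => [|e IH].
  by rewrite addn0 /twisted_exp big_ord0 iter_rmorph1 mulr1.
by rewrite addnS !twisted_expS IH iter_rmorphM iterD mulrA.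
Qed.

End TwistedPower.

Lemma twisted_exp_map (R R' : comPzRingType) (sigma : {rmorphism R -> R})
    (tau : {rmorphism R' -> R'}) (f : {rmorphism R -> R'}) c d :
  (forall a, f (sigma a) = tau (f a)) ->
  f (twisted_exp sigma c d) = twisted_exp tau (f c) d.
Proof.
move=> fs; rewrite rmorph_prod; apply: eq_bigr => i _.
by elim: (i : nat) => //= j <-.
Qed.

(* The ring morphism f on coefficients together with x_i |-> c x_i; the latter
   is compatible with x_i a = sigma(a) x_i because scalars commute. *)
HB.lock Definition ore_subst (n : nat) (R R' : comPzRingType)
    (sigma : {rmorphism R -> R}) (tau : {rmorphism R' -> R'})
    (f : {rmorphism R -> R'}) of (forall a, f (sigma a) = tau (f a)) :=
  fun (c : R') (p : ore n sigma) =>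
  \sum_(k <- msupp p) oreU tau (f p@_k * twisted_exp tau c (mdeg k)) k.

Section OreSubst.
Variables (n : nat) (R R' : comPzRingType).
Variables (sigma : {rmorphism R -> R}) (tau : {rmorphism R' -> R'}).
Variables (f : {rmorphism R -> R'}).
Hypothesis fs : forall a, f (sigma a) = tau (f a).
Variable c : R'.
Local Notation Phi := (@ore_subst n _ _ _ _ _ fs c).
Implicit Types p q : ore n sigma.

Lemma ore_substE p k : (Phi p)@_k = f p@_k * twisted_exp tau c (mdeg k).
Proof.
rewrite unlock ore_coef_sum [in RHS](ore_sumU p) ore_coef_sum rmorph_sum.
rewrite mulr_suml; apply: eq_bigr => l _; rewrite !oreUE rmorphMn mulrnAl.
by case: eqP => [->|_].
Qed.

Lemma ore_subst_is_zmod_morphism : zmod_morphism Phi.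
Proof.
move=> p q; apply: oreP => k.
by rewrite ore_coefB !ore_substE ore_coefB rmorphB mulrBl.
Qed.

HB.instance Definition _ := GRing.isZmodMorphism.Build (ore n sigma) (ore n tau)
  Phi ore_subst_is_zmod_morphism.

Lemma ore_substU a (k : 'X_{1..n}) :
  Phi (oreU sigma a k) = oreU tau (f a * twisted_exp tau c (mdeg k)) k.
Proof.
apply: oreP => l; rewrite ore_substE !oreUE rmorphMn mulrnAl.
by case: eqP => [->|_].
Qed.

Lemma ore_subst_is_monoid_morphism : monoid_morphism Phi.
Proof.
split.
  by rewrite [LHS]ore_substU rmorph1 mdeg1 mul1r /twisted_exp big_ord0.
move=> p q; elim/ore_ind: p => [|p p' ep ep'|a k].
- by rewrite raddf0 !mul0r raddf0.
- by rewrite raddfD !mulrDl raddfD /= ep ep'.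
elim/ore_ind: q => [|q q' eq eq'|b l].
- by rewrite raddf0 !mulr0 raddf0.
- by rewrite raddfD !mulrDr raddfD /= eq eq'.
rewrite oreUU !ore_substU oreUU; congr (oreU _ _ _).
rewrite mdegM twisted_expD /twist rmorphM iter_rmorphM.
have -> : f (iter (mdeg k) sigma b) = iter (mdeg k) tau (f b).
  by elim: (mdeg k) => //= d <-.
by rewrite mulrACA.
Qed.

HB.instance Definition _ := GRing.isMonoidMorphism.Build
  (ore n sigma) (ore n tau) Phi ore_subst_is_monoid_morphism.

End OreSubst.

(** Coefficients commute and [twisted_exp] is multiplicative, so dilation constants multiply under
    composition once [c] is transported along [g]. The later compositions of dilations with
    coefficient maps are instances of this. *)
Lemma map_ore_subst_comp (n : nat) (R1 R2 R3 : comPzRingType)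
    (s1 : {rmorphism R1 -> R1}) (s2 : {rmorphism R2 -> R2})
    (s3 : {rmorphism R3 -> R3})
    (f : {rmorphism R1 -> R2}) (fs : forall a, f (s1 a) = s2 (f a))
    (g : {rmorphism R2 -> R3}) (gs : forall a, g (s2 a) = s3 (g a))
    (h : {rmorphism R1 -> R3}) (hs : forall a, h (s1 a) = s3 (h a))
    c d e (r s : nat) (M : 'M[ore n s1]_(r, s)) :
  (forall a, g (f a) = h a) -> g c * d = e ->
  map_mx (ore_subst gs d) (map_mx (ore_subst fs c) M) =
  map_mx (ore_subst hs e) M.
Proof.
move=> gf <-; apply/matrixP => i j; rewrite !mxE; apply: oreP => k.
by rewrite !ore_substE rmorphM gf (twisted_exp_map _ _ gs) twisted_expM mulrA.
Qed.

(** Since [twisted_exp 0 d] is 1 for [d = 0] and 0 otherwise, dilating by 0 keeps exactly the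
    constant terms. *)
Lemma mx_constE (n r s : nat) (R : comPzRingType) (sigma : {rmorphism R -> R})
    (ids : forall a, idfun (sigma a) = sigma (idfun a))
    (F : 'M[ore n sigma]_(r, s)) :
  mx_const F = map_mx (ore_subst ids 0) F.
Proof.
apply/matrixP => i j; rewrite !mxE; apply: oreP => k.
rewrite ore_substE /oreC oreUE twisted_exp0 mdeg_eq0 /= eq_sym.
by case: eqP => [->|_]; rewrite ?mulr1 ?mulr0.
Qed.

(** * Polynomials in generic dilation parameters *)

Section MonomialEval.
Variables (I : choiceType) (S : comNzRingType) (x : I -> S).

Definition monom_eval (m : cmonom I) : S := \prod_(i <- finsupp m) x i ^+ m i.

Lemma monom_evalEw (d : {fset I}) (m : cmonom I) : (finsupp m `<=` d)%fset ->
  monom_eval m = \prod_(i <- d) x i ^+ m i.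
Proof.
move=> le; rewrite /monom_eval (big_fset_incl _ le) // => i _.
by rewrite -cmE_eq0 => /eqP ->.
Qed.

Lemma monom_eval_is_mmorphism : mmorphism monom_eval.
Proof.
split=> [m1 m2|]; last by rewrite /monom_eval mdom1 big_seq_fset0.
rewrite {1}/monom_eval mdomD (monom_evalEw (fsubsetUl _ (finsupp m2))).
rewrite (monom_evalEw (fsubsetUr (finsupp m1) _)) -big_split /=.
by apply: eq_bigr => i _; rewrite cmM exprD.
Qed.

HB.instance Definition _ :=
  isMultiplicative.Build (cmonom I) S monom_eval monom_eval_is_mmorphism.

Lemma monom_evalU i : monom_eval (ucm i) = x i.
Proof. by rewrite /monom_eval mdomU big_seq_fset1 cmUU. Qed.

End MonomialEval.

(* The ring R[y_0, y_1, ..., z_0, z_1, ...]: the variable indexed by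
   (false, i) is y_i and the one indexed by (true, i) is z_i. *)
Definition gen (R : comNzRingType) : comNzRingType :=
  {malg R[cmonom (bool * nat)%type]}.
HB.lock Definition genU (R : comNzRingType) (a : R)
    (m : cmonom (bool * nat)%type) : gen R :=
  (<< a *g m >> : {malg R[cmonom (bool * nat)%type]}).
Definition genX (R : comNzRingType) (i : bool * nat) : gen R := genU 1 (ucm i).
HB.lock Definition genC (R : comNzRingType) : {rmorphism R -> gen R} :=
  @mkmalgU (cmonom (bool * nat)%type) R 1%M.
HB.lock Definition gen_eval (R S : comNzRingType) (f : {rmorphism R -> S})
    (x : bool * nat -> S) : {rmorphism gen R -> S} :=
  @mmap (cmonom (bool * nat)%type) R S f (monom_eval x).

Section GenEval.
Variables (R S : comNzRingType) (f : {rmorphism R -> S}) (x : bool * nat -> S).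
Local Notation gen_eval := (gen_eval f x).

Lemma gen_evalC a : gen_eval (genC R a) = f a.
Proof. by rewrite !unlock; apply: mmapC. Qed.

Lemma gen_evalU a m : gen_eval (genU a m) = f a * monom_eval x m.
Proof. by rewrite !unlock; apply: mmapU. Qed.

Lemma gen_evalX i : gen_eval (genX R i) = x i.
Proof.
by rewrite gen_evalU rmorph1 mul1r monom_evalU.
Qed.

End GenEval.

Section GenTheory.
Variable R : comNzRingType.
Local Notation K := (cmonom (bool * nat)%type).

Lemma genUM (a b : R) m l : genU a m * genU b l = genU (a * b) (m * l)%M.
Proof. by rewrite !unlock [LHS]malgM_def fgmulUU. Qed.

Lemma genUE (a : R) m : genU a m = genC R a * genU 1 m.
Proof.
have -> : genC R a = genU a 1%M by rewrite !unlock.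
by rewrite genUM mulr1 mul1m.
Qed.

(** Induction on the degree, splitting off one variable at a time. This is what makes a morphism on
    [gen R] determined by its values on constants and variables. *)
Lemma monom_eval_genX m : monom_eval (@genX R) m = genU (1 : R) m.
Proof.
elim: {m}(mdeg m) {-2}m (erefl (mdeg m)) => [|d IH] m dm.
  by rewrite (mdeg_eq0I dm) mmorph1 genU.unlock.
have [i mi] : exists i, m i != 0%N.
  have : m != 1%M by rewrite -mdeg_eq0 dm.
  move/cmP => ne; apply: contrapT => h; apply: ne => i.
  by rewrite cm1; apply: contrapT => /eqP mi; apply: h; exists i.
have e : m = (ucm i * divcm m (ucm i))%M.
  apply/eqP/cmP => j; rewrite cmM divcmE cmU.
  by case: eqP => [<-|_]; [rewrite subnKC // lt0n | rewrite subn0].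
have dm' : mdeg (divcm m (ucm i)) = d.
  by move: dm; rewrite {1}e mdegM mdegU => -[].
by rewrite e mmorphM /= monom_evalU IH // genUM mul1r.
Qed.

Lemma gen_sumU (b : gen R) :
  b = \sum_(m <- msupp (b : {malg R[K]})) genU (b : {malg R[K]})@_m m.
Proof.
rewrite [LHS](monalgE (b : {malg R[K]})); apply: eq_bigr => m _.
by rewrite unlock.
Qed.

Lemma gen_ind (P : gen R -> Prop) :
  P 0 -> (forall p q, P p -> P q -> P (p + q)) ->
  (forall (a : R) m, P (genU a m)) -> forall p, P p.
Proof.
move=> P0 PD PU p; rewrite (gen_sumU p).
by apply: big_ind => // m _; apply: PU.
Qed.

Lemma gen_rmorph_ext (S : pzRingType) (g h : {rmorphism gen R -> S}) :
  (forall a, g (genC R a) = h (genC R a)) ->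
  (forall i, g (genX R i) = h (genX R i)) -> forall b, g b = h b.
Proof.
move=> eC eX; elim/gen_ind => [|p q ep eq|a m]; first by rewrite !rmorph0.
  by rewrite !rmorphD ep eq.
rewrite genUE -monom_eval_genX [g _]rmorphM [h _]rmorphM eC.
congr (_ * _); rewrite /monom_eval [g _]rmorph_prod [h _]rmorph_prod.
by apply: eq_bigr => i _; rewrite [g _]rmorphXn [h _]rmorphXn eX.
Qed.

End GenTheory.

(** The variables [y_i] and [z_i] play the role of [sigma^i(y)] and [sigma^i(z)]. As they are
    independent, any pair of elements of [R] is a specialization of [(y, z)] compatible with
    [sigma]. *)
HB.lock Definition gen_shift (R : comNzRingType) (sigma : {rmorphism R -> R}) :
    {rmorphism gen R -> gen R} :=
  gen_eval (genC R \o sigma) (fun i => genX R (i.1, i.2.+1)).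

Definition gen_scale_coef (R : comNzRingType) (sigma : {rmorphism R -> R})
    (v : R) (i : bool * nat) : R :=
  if i.1 then iter i.2 sigma v else 1.

(* z_i |-> sigma^i(v) z_i, the substitution z |-> v z when z_i = sigma^i(z). *)
HB.lock Definition gen_scale (R : comNzRingType) (sigma : {rmorphism R -> R})
    (v : R) : {rmorphism gen R -> gen R} :=
  gen_eval (genC R) (fun i => genC R (gen_scale_coef sigma v i) * genX R i).

HB.lock Definition gen_spec (R : comNzRingType) (sigma : {rmorphism R -> R})
    (a r : R) : {rmorphism gen R -> R} :=
  gen_eval idfun (fun i => iter i.2 sigma (if i.1 then r else a)).

HB.lock Definition gen_map (R R' : comNzRingType) (f : {rmorphism R -> R'}) :
    {rmorphism gen R -> gen R'} :=
  gen_eval (genC R' \o f) (@genX R').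

Section GenShift.
Variables (R : comNzRingType) (sigma : {rmorphism R -> R}).
Local Notation K := (cmonom (bool * nat)%type).
Local Notation gen_shift := (gen_shift sigma).
Local Notation gen_scale_coef := (gen_scale_coef sigma).
Local Notation gen_scale := (gen_scale sigma).
Local Notation gen_spec := (gen_spec sigma).

Lemma genC_shift a : genC R (sigma a) = gen_shift (genC R a).
Proof. by rewrite gen_shift.unlock gen_evalC. Qed.

Lemma gen_shiftX i : gen_shift (genX R i) = genX R (i.1, i.2.+1).
Proof. by rewrite unlock; apply: gen_evalX. Qed.

Lemma gen_scaleC v a : gen_scale v (genC R a) = genC R a.
Proof. by rewrite gen_scale.unlock; apply: gen_evalC. Qed.

Lemma gen_scaleX v i :
  gen_scale v (genX R i) = genC R (gen_scale_coef v i) * genX R i.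
Proof. by rewrite gen_scale.unlock; apply: gen_evalX. Qed.

Lemma gen_scale_shift v b :
  gen_scale v (gen_shift b) = gen_shift (gen_scale v b).
Proof.
move: b; apply: (gen_rmorph_ext (g := gen_scale v \o gen_shift)
                                (h := gen_shift \o gen_scale v)) => [a|[b i]] /=.
  by rewrite -genC_shift !gen_scaleC genC_shift.
rewrite gen_shiftX !gen_scaleX rmorphM /= gen_shiftX -genC_shift /=.
by case: b; rewrite /gen_scale_coef /= ?rmorph1.
Qed.

(** The product of the [sigma^i(v)^e] over the powers [z_i^e] in [m]. The substitution is diagonal
    on monomials, with this factor. *)
Definition gen_scale_monom (v : R) (m : K) : R := monom_eval (gen_scale_coef v) m.

Lemma gen_scaleU v a m : gen_scale v (genU a m) = genU (a * gen_scale_monom v m) m.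
Proof.
rewrite genUE rmorphM /= gen_scaleC -(monom_eval_genX R m) rmorph_prod.
under eq_bigr => i _ do rewrite rmorphXn /= gen_scaleX exprMn -rmorphXn.
rewrite big_split -rmorph_prod /= (_ : \prod_(i <- _) _ = genU 1 m); last first.
  exact: monom_eval_genX.
by rewrite mulrA -rmorphM -genUE.
Qed.

Lemma gen_specC a r c : gen_spec a r (genC R c) = c.
Proof. by rewrite gen_spec.unlock; apply: gen_evalC. Qed.

Lemma gen_specX a r i :
  gen_spec a r (genX R i) = iter i.2 sigma (if i.1 then r else a).
Proof. by rewrite unlock; apply: gen_evalX. Qed.

Lemma gen_spec_shift a r b :
  gen_spec a r (gen_shift b) = sigma (gen_spec a r b).
Proof.
move: b; apply: (gen_rmorph_ext (g := gen_spec a r \o gen_shift)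
                                (h := sigma \o gen_spec a r)) => [c|[b i]] /=.
  by rewrite -genC_shift !gen_specC.
by rewrite gen_shiftX !gen_specX.
Qed.

End GenShift.

Section GenMap.
Variables (R R' : comNzRingType).
Variables (sigma : {rmorphism R -> R}) (tau : {rmorphism R' -> R'}).
Variables (f : {rmorphism R -> R'}).
Hypothesis fs : forall a, f (sigma a) = tau (f a).
Local Notation gen_map := (gen_map f).

Lemma gen_mapC a : gen_map (genC R a) = genC R' (f a).
Proof. by rewrite gen_map.unlock; apply: gen_evalC. Qed.

Lemma gen_mapX i : gen_map (genX R i) = genX R' i.
Proof. by rewrite gen_map.unlock; apply: gen_evalX. Qed.

Lemma gen_map_shift b : gen_map (gen_shift sigma b) = gen_shift tau (gen_map b).
Proof.
move: b; apply: (gen_rmorph_ext (g := gen_map \o gen_shift sigma)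
                                (h := gen_shift tau \o gen_map)) => [a|i] /=.
  by rewrite -genC_shift !gen_mapC -genC_shift fs.
by rewrite gen_shiftX !gen_mapX gen_shiftX.
Qed.

Lemma rmorph_iter i a : f (iter i sigma a) = iter i tau (f a).
Proof. by elim: i => //= i <-. Qed.

Lemma gen_mapU a m : gen_map (genU a m) = genU (f a) m.
Proof. by rewrite gen_map.unlock gen_evalU monom_eval_genX -genUE. Qed.

Lemma gen_mapE (b : gen R) m :
  (gen_map b : {malg R'[cmonom (bool * nat)%type]})@_m =
  f (b : {malg R[cmonom (bool * nat)%type]})@_m.
Proof.
elim/gen_ind: b => [|p q ep eq|a l]; first by rewrite rmorph0 !mcoeff0 rmorph0.
  by rewrite rmorphD /= !mcoeffD ep eq rmorphD.
by rewrite gen_mapU genU.unlock !mcoeffU rmorphMn.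
Qed.

Lemma gen_scale_monom_map v m :
  gen_scale_monom tau (f v) m = f (gen_scale_monom sigma v m).
Proof.
rewrite /gen_scale_monom /monom_eval rmorph_prod; apply: eq_bigr => i _.
by rewrite rmorphXn /gen_scale_coef; case: i.1; rewrite ?rmorph_iter ?rmorph1.
Qed.

End GenMap.

(** * Clearing denominators by a dilation of z *)

Section Clearing.
Variables (R R' : comNzRingType).
Variables (sigma : {rmorphism R -> R}) (tau : {rmorphism R' -> R'}).
Variables (f : {rmorphism R -> R'}).
Hypothesis fs : forall a, f (sigma a) = tau (f a).
Variable S : {pred R}.
Hypothesis hS : GRing.mulr_closed S.
Hypothesis sigmaS : forall u, u \in S -> exists2 v, v \in S & sigma v = u.
Hypothesis frac : forall q, exists s p, s \in S /\ f s * q = f p.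
Hypothesis tors : forall a, f a = 0 -> exists u, u \in S /\ u * a = 0.
Local Notation K := (cmonom (bool * nat)%type).

(** Reads: [P] holds for all sufficiently divisible [v]. Asking for all multiples of one element of
    [S] makes the notion stable under finite conjunctions. *)
Definition for_multiples (P : R -> Prop) : Prop :=
  exists2 v, v \in S & forall w, P (v * w).

Lemma for_multiplesT (P : R -> Prop) : (forall v, P v) -> for_multiples P.
Proof. by move=> h; exists 1; first exact: hS.1. Qed.

Lemma for_multiplesW (P Q : R -> Prop) :
  (forall v, P v -> Q v) -> for_multiples P -> for_multiples Q.
Proof. by move=> h [v vS Pv]; exists v => // w; apply/h/Pv. Qed.

Lemma for_multiplesI (P Q : R -> Prop) :
  for_multiples P -> for_multiples Q -> for_multiples (fun v => P v /\ Q v).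
Proof.
move=> [v vS Pv] [u uS Qu]; exists (v * u); first exact: hS.2.
move=> w; split; first by rewrite -mulrA; apply: Pv.
by rewrite (mulrC v) -mulrA; apply: Qu.
Qed.

Lemma for_multiples_seq (T : eqType) (s : seq T) (P : T -> R -> Prop) :
  (forall x, for_multiples (P x)) ->
  for_multiples (fun v => forall x, x \in s -> P x v).
Proof.
move=> h; elim: s => [|x s IH]; first exact: for_multiplesT.
apply: for_multiplesW (for_multiplesI (h x) IH) => v [Px Ps] y.
by rewrite inE => /predU1P[->|/Ps].
Qed.

Lemma for_multiples_fin (T : finType) (P : T -> R -> Prop) :
  (forall x, for_multiples (P x)) ->
  for_multiples (fun v => forall x, P x v).
Proof.
move=> h; apply: for_multiplesW (for_multiples_seq (enum T) h) => v Pv x.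
by apply: Pv; rewrite mem_enum.
Qed.

Lemma iter_preimage i u : u \in S -> exists2 v, v \in S & iter i sigma v = u.
Proof.
elim: i u => [|i IH] u uS; first by exists u.
have [w wS <-] := sigmaS uS; have [v vS <-] := IH w wS.
by exists v.
Qed.

(** A monomial without any [z_i] is fixed by the scaling. If some [z_i] occurs, the factor is a
    multiple of [sigma^i(v)]; it vanishes at [v = 0], and it is divisible by [u] for all multiples
    of a [v] in [S] with [sigma^i(v) = u]. *)
Lemma gen_scale_monomP (m : K) :
  (forall v, gen_scale_monom sigma v m = 1) \/
  gen_scale_monom sigma 0 m = 0 /\
  forall u, u \in S ->
    for_multiples (fun v => exists t, gen_scale_monom sigma v m = u * t).
Proof.
have [[i mi]|h] := pselect (exists i, m (true, i) != 0%N); last first.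
  left=> v; rewrite /gen_scale_monom /monom_eval big1_seq // => -[[] i] /=.
    rewrite -cmE_neq0 => mi; by case: h; exists i.
  by rewrite expr1n.
have split v : exists t, gen_scale_monom sigma v m = iter i sigma v * t.
  rewrite /gen_scale_monom /monom_eval (big_fsetD1 (true, i)) -?cmE_neq0 //=.
  case: (m (true, i)) mi => // d _.
  by rewrite exprS -mulrA; eexists.
right; split.
  have [t ->] := split 0.
  rewrite (_ : iter i sigma 0 = 0) ?mul0r //.
  by elim: (i) => //= j ->; rewrite rmorph0.
move=> u /(iter_preimage i)[v vS <-]; exists v => // w.
have [t ->] := split (v * w); exists (iter i sigma w * t).
by rewrite iter_rmorphM mulrA.
Qed.

(* Replacing z by v z makes the part of positive degree in z integral. *)
Lemma gen_lift (b : gen R') :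
  for_multiples (fun v => exists2 c : gen R,
    gen_map f c = gen_scale tau (f v) b - gen_scale tau 0 b
    & gen_scale sigma 0 c = 0).
Proof.
elim/gen_ind: b => [|p q ep eq|a m].
- apply: for_multiplesT => v; exists (0 : gen R).
    rewrite (rmorph0 (gen_map f)).
    rewrite [in RHS](rmorph0 (gen_scale tau (f v))).
    rewrite [in RHS](rmorph0 (gen_scale tau 0)).
    by rewrite subrr.
  by rewrite (rmorph0 (gen_scale sigma 0)).
- apply: for_multiplesW (for_multiplesI ep eq) => v [[c ec c0] [d ed d0]].
  exists (c + d); last by rewrite (rmorphD (gen_scale _ _)) /= c0 d0 addr0.
  rewrite (rmorphD (gen_map f)) !(rmorphD (gen_scale _ _)) /= ec ed.
  by rewrite opprD addrACA.
have [h|[h0 h]] := gen_scale_monomP m.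
  apply: for_multiplesT => v; exists 0.
    rewrite (rmorph0 (gen_map f)) !gen_scaleU -(rmorph0 f).
    by rewrite !(gen_scale_monom_map fs) !h subrr.
  by rewrite (rmorph0 (gen_scale _ _)).
have [s [p [sS e]]] := frac a.
apply: for_multiplesW (h s sS) => v [t et].
(* As [f s * a = f p] and the scaling factor is [s * t], the new coefficient [a * f (s * t)] equals
   [f (p * t)]. *)
exists (genU (p * t) m); last first.
  by rewrite gen_scaleU h0 mulr0 genUE (rmorph0 (genC R)) mul0r.
rewrite gen_mapU !gen_scaleU -(rmorph0 f) !(gen_scale_monom_map fs) h0 et.
rewrite (rmorph0 f) mulr0 (genUE 0) (rmorph0 (genC R')) mul0r subr0.
by rewrite !(rmorphM f) -e mulrCA mulrA.
Qed.

(** Each coefficient of [b] is killed by some [u] in [S]. Terms containing a [z_i] vanish once their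
    factor is divisible by [u]; the other terms do not depend on [v]. *)
Lemma gen_kill (b : gen R) : gen_map f b = 0 ->
  for_multiples (fun v => gen_scale sigma v b = gen_scale sigma 0 b).
Proof.
move=> b0; have bm (m : K) : f (b : {malg R[K]})@_m = 0.
  by rewrite -gen_mapE b0 mcoeff0.
have h (m : K) : for_multiples (fun v =>
    gen_scale sigma v (genU (b : {malg R[K]})@_m m) =
    gen_scale sigma 0 (genU (b : {malg R[K]})@_m m)).
  have [u [uS e]] := tors (bm m).
  have [h|[h0 h]] := gen_scale_monomP m.
    by apply: for_multiplesT => v; rewrite !gen_scaleU !h.
  apply: for_multiplesW (h u uS) => v [t et].
  by rewrite !gen_scaleU h0 et mulrA (mulrC _ u) e mulr0 mul0r.
apply: for_multiplesW (for_multiples_seq (enum_fset (msupp (b : {malg R[K]}))) h).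
move=> v hv; rewrite (gen_sumU b) !(rmorph_sum (gen_scale _ _)) /= big_seq [RHS]big_seq.
by apply: eq_bigr => m /hv.
Qed.

(** * Lifting and cancellation for Ore polynomials and their matrices *)

Section OreClearing.
Variable n : nat.
Local Notation theta v := (ore_subst (n := n) (gen_scale_shift sigma v) 1).
Local Notation theta' v := (ore_subst (n := n) (gen_scale_shift tau v) 1).
Local Notation loc := (ore_subst (n := n) (gen_map_shift fs) 1).

(** Reduces to [gen_lift] on each coefficient: the dilation constants are 1, so [theta], [theta']
    and [loc] act on coefficients only. *)
Lemma ore_lift (p : ore n (gen_shift tau)) :
  for_multiples (fun v => exists2 c : ore n (gen_shift sigma),
    loc c = theta' (f v) p - theta' 0 p & theta 0 c = 0).
Proof.
elim/ore_ind: p => [|p q ep eq|b k].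
- apply: for_multiplesT => v; exists 0; last exact: (raddf0 (theta 0)).
  by rewrite (raddf0 loc) (raddf0 (theta' (f v))) (raddf0 (theta' 0)) subrr.
- apply: for_multiplesW (for_multiplesI ep eq) => v [[c ec c0] [d ed d0]].
  exists (c + d); last by rewrite (raddfD (theta 0)) /= c0 d0 addr0.
  rewrite (raddfD loc) (raddfD (theta' (f v))) (raddfD (theta' 0)) /= ec ed.
  by rewrite opprD addrACA.
apply: for_multiplesW (gen_lift b) => v [c ec c0].
exists (oreU (gen_shift sigma) c k).
  by rewrite !ore_substU !twisted_exp1 !mulr1 -oreUB -ec.
by rewrite ore_substU c0 mul0r oreU0.
Qed.

Lemma ore_kill (p : ore n (gen_shift sigma)) : loc p = 0 ->
  for_multiples (fun v => theta v p = theta 0 p).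
Proof.
move=> p0; have pk k : gen_map f p@_k = 0.
  by rewrite -[LHS]mulr1 -(twisted_exp1 (gen_shift tau) (mdeg k))
             -(ore_substE (gen_map_shift fs)) p0 ore_coef0.
have := for_multiples_seq (enum_fset (msupp p)) (fun k => gen_kill (pk k)).
apply: for_multiplesW => v hv; apply: oreP => k; rewrite !ore_substE.
have [/hv -> //|/mcoeff_outdom ->] := boolP (k \in msupp p).
by rewrite !rmorph0.
Qed.

Variables (r s : nat).

Lemma mx_lift (M : 'M[ore n (gen_shift tau)]_(r, s)) :
  for_multiples (fun v => exists2 N : 'M[ore n (gen_shift sigma)]_(r, s),
    map_mx loc N = map_mx (theta' (f v)) M - map_mx (theta' 0) M
    & map_mx (theta 0) N = 0).
Proof.
have := for_multiples_fin (fun ij : 'I_r * 'I_s => ore_lift (M ij.1 ij.2)).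
apply: for_multiplesW => v h.
have [N NE N0] := fin_all_exists2 h.
exists (\matrix_(i, j) N (i, j)); apply/matrixP => i j; rewrite !mxE.
  exact: NE (i, j).
exact: N0 (i, j).
Qed.

(** The difference of two entries is killed by [loc], so for suitable [v] its image under [theta v]
    equals its value at [z = 0], which is zero. *)
Lemma mx_kill (M N : 'M[ore n (gen_shift sigma)]_(r, s)) :
  map_mx loc M = map_mx loc N -> map_mx (theta 0) M = map_mx (theta 0) N ->
  for_multiples (fun v => map_mx (theta v) M = map_mx (theta v) N).
Proof.
move=> /matrixP eMN /matrixP eMN0.
have h (ij : 'I_r * 'I_s) :
    for_multiples (fun v => theta v (M ij.1 ij.2) = theta v (N ij.1 ij.2)).
  have e : loc (M ij.1 ij.2 - N ij.1 ij.2) = 0.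
    by rewrite (raddfB loc); have := eMN ij.1 ij.2; rewrite !mxE /= => ->; rewrite subrr.
  apply: for_multiplesW (ore_kill e) => v.
  rewrite (raddfB (theta v)) (raddfB (theta 0)) /=.
  have := eMN0 ij.1 ij.2; rewrite !mxE /= => ->; rewrite subrr.
  by move/eqP; rewrite subr_eq0 => /eqP.
apply: for_multiplesW (for_multiples_fin h) => v hv.
by apply/matrixP => i j; rewrite !mxE; apply: (hv (i, j)).
Qed.

End OreClearing.

End Clearing.

(** * Local equivalence gives invariance under small dilations *)

Section LocalDilation.
Variables (R R' : comNzRingType).
Variables (sigma : {rmorphism R -> R}) (tau : {rmorphism R' -> R'}).
Variables (f : {rmorphism R -> R'}).
Hypothesis fs : forall a, f (sigma a) = tau (f a).
Variable S : {pred R}.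
Hypothesis hS : GRing.mulr_closed S.
Hypothesis sigmaS : forall u, u \in S -> exists2 v, v \in S & sigma v = u.
Hypothesis frac : forall q, exists s p, s \in S /\ f s * q = f p.
Hypothesis tors : forall a, f a = 0 -> exists u, u \in S /\ u * a = 0.
Variable n : nat.
Local Notation theta v := (ore_subst (n := n) (gen_scale_shift sigma v) 1).
Local Notation theta' v := (ore_subst (n := n) (gen_scale_shift tau v) 1).
Local Notation loc := (ore_subst (n := n) (gen_map_shift fs) 1).
Local Notation ev := (for_multiples S).

(** Only the part of [U] that vanishes at [z = 0] has to be lifted; the identity is added back. The
    value 1 of the lift at [z = 0] is what makes [mx_kill] applicable to identities between such
    lifts. *)
Lemma mx_lift1 r (U : 'M[ore n (gen_shift tau)]_r) :
  map_mx (theta' 0) U = 1%:M ->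
  ev (fun v => exists2 V : 'M[ore n (gen_shift sigma)]_r,
    map_mx loc V = map_mx (theta' (f v)) U & map_mx (theta 0) V = 1%:M).
Proof.
move=> U0; apply: for_multiplesW (mx_lift fs hS sigmaS frac U) => v [N NE N0].
exists (1%:M + N).
  rewrite (map_mxD loc) (map_mx1 loc) NE U0 addrC; exact: subrK.
rewrite (map_mxD (theta 0)) (map_mx1 (theta 0)) N0; exact: addr0.
Qed.

(** The identity [V *m V' = 1] holds after localization and at [z = 0]; by [mx_kill] one further
    scaling makes it exact. *)
Lemma mx_lift_inverse r (U U' : 'M[ore n (gen_shift tau)]_r) :
  U *m U' = 1%:M -> map_mx (theta' 0) U = 1%:M -> map_mx (theta' 0) U' = 1%:M ->
  forall v (V V' : 'M[ore n (gen_shift sigma)]_r),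
  map_mx loc V = map_mx (theta' (f v)) U -> map_mx (theta 0) V = 1%:M ->
  map_mx loc V' = map_mx (theta' (f v)) U' -> map_mx (theta 0) V' = 1%:M ->
  ev (fun u => map_mx (theta u) V *m map_mx (theta u) V' = 1%:M).
Proof.
move=> UU' U0 U0' v V V' VE V0 VE' V0'.
have := @mx_kill _ _ _ _ _ fs _ hS sigmaS tors n _ _ (V *m V') 1%:M.
rewrite (map_mxM loc) (map_mxM (theta 0)) (map_mx1 loc) (map_mx1 (theta 0)).
rewrite VE VE' V0 V0' mulmx1 -(map_mxM (theta' (f v))) UU' (map_mx1 (theta' (f v))).
move=> /(_ erefl erefl); apply: for_multiplesW => u.
rewrite (map_mxM (theta u)) (map_mx1 (theta u)) => e; exact: e.
Qed.

Local Notation loc0 := (ore_subst (n := n) fs 1).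
Local Notation dil c := (ore_subst (n := n) (genC_shift sigma) c).
Local Notation dil' c := (ore_subst (n := n) (genC_shift tau) c).

(** The entries of [M] have coefficients in [R], which the scaling fixes, so it acts on the
    parameter [c] alone. *)
Lemma map_theta_dil (r s : nat) v c (M : 'M[ore n sigma]_(r, s)) :
  map_mx (theta v) (map_mx (dil c) M) = map_mx (dil (gen_scale sigma v c)) M.
Proof.
by apply: map_ore_subst_comp => [a|]; [apply: gen_scaleC | apply: mulr1].
Qed.

Lemma map_theta_dil' (r s : nat) v c (M : 'M[ore n tau]_(r, s)) :
  map_mx (theta' v) (map_mx (dil' c) M) = map_mx (dil' (gen_scale tau v c)) M.
Proof.
by apply: map_ore_subst_comp => [a|]; [apply: gen_scaleC | apply: mulr1].
Qed.

Let genCf_shift a : (genC R' \o f) (sigma a) = gen_shift tau ((genC R' \o f) a).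
Proof. by rewrite /= fs genC_shift. Qed.

Lemma map_loc_dil (r s : nat) c (M : 'M[ore n sigma]_(r, s)) :
  map_mx loc (map_mx (dil c) M) = map_mx (dil' (gen_map f c)) (map_mx loc0 M).
Proof.
transitivity (map_mx (ore_subst genCf_shift (gen_map f c)) M).
  by apply: map_ore_subst_comp => [a|]; [apply: gen_mapC | apply: mulr1].
apply/esym/map_ore_subst_comp => [a //|].
by rewrite (rmorph1 (genC R')) mul1r.
Qed.

(** The right-hand side does not involve [c]: constant matrices are invariant under dilation. Two
    dilations of [P F(0) Q] therefore share their middle factor. *)
Lemma map_dil_const (r s : nat) c (F : 'M[ore n sigma]_(r, s)) :
  map_mx (dil' c) (map_mx loc0 (mx_const F)) =
  map_mx (ore_subst genCf_shift 0) F.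
Proof.
have ids a : idfun (sigma a) = sigma (idfun a) by [].
rewrite (mx_constE ids) (map_ore_subst_comp ids fs fs (e := 0)) //; last first.
  by rewrite (rmorph0 f) mul0r.
by apply: map_ore_subst_comp => //; rewrite (rmorph0 (genC R')) mul0r.
Qed.

(** The product telescopes. With [g] and [h] two dilations, this shows that the transition matrices
    between them are invertible. *)
Lemma conj_mulmx1 (A B : pzRingType) (g h : {rmorphism A -> B}) (r : nat)
    (P P' : 'M[A]_r) : P *m P' = 1%:M -> P' *m P = 1%:M ->
  (map_mx g P *m map_mx h P') *m (map_mx h P *m map_mx g P') = 1%:M.
Proof.
move=> PP' P'P; rewrite mulmxA -(mulmxA (map_mx g P)) -(map_mxM h) P'P.
by rewrite map_mx1 mulmx1 -(map_mxM g) PP' map_mx1.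
Qed.

Local Notation Y := (genX R (false, 0%N)).
Local Notation Z := (genX R (true, 0%N)).
Local Notation Y' := (genX R' (false, 0%N)).
Local Notation Z' := (genX R' (true, 0%N)).

Lemma gen_scaleY (T : comNzRingType) (rho : {rmorphism T -> T}) v :
  gen_scale rho v (genX T (false, 0%N)) = genX T (false, 0%N).
Proof. by rewrite gen_scaleX (rmorph1 (genC T)) mul1r. Qed.

Lemma gen_scaleYZ (T : comNzRingType) (rho : {rmorphism T -> T}) v a :
  gen_scale rho v (genX T (false, 0%N) + genC T a * genX T (true, 0%N)) =
  genX T (false, 0%N) + genC T (a * v) * genX T (true, 0%N).
Proof.
rewrite (rmorphD (gen_scale rho v)) (rmorphM (gen_scale rho v)) /= gen_scaleY.
by rewrite gen_scaleX gen_scaleC mulrA -(rmorphM (genC T)).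
Qed.

(** At [z = 0] both parameters become [y], and the product becomes the dilation of [P *m P' = 1]. *)
Lemma theta'0_inverse r (P P' : 'M[ore n tau]_r) c d :
  gen_scale tau 0 c = Y' -> gen_scale tau 0 d = Y' -> P *m P' = 1%:M ->
  map_mx (theta' 0) (map_mx (dil' c) P *m map_mx (dil' d) P') = 1%:M.
Proof.
move=> c0 d0 PP'; rewrite (map_mxM (theta' 0)) !map_theta_dil' c0 d0.
by rewrite -(map_mxM (dil' Y')) PP' (map_mx1 (dil' Y')).
Qed.

Lemma generic_dilation (r s : nat) (F : 'M[ore n sigma]_(r, s)) :
  mx_equiv (map_mx loc0 F) (map_mx loc0 (mx_const F)) ->
  exists2 v, v \in S &
    mx_equiv (map_mx (dil (Y + genC R v * Z)) F) (map_mx (dil Y) F).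
Proof.
move=> [P [Q [[P' [PP' P'P]] [Q' [QQ' Q'Q]] FE]]].
(* The coefficient 1 is written out so that [gen_scaleYZ] applies to [c]. *)
pose c := Y' + genC R' 1 * Z'.
have c0 : gen_scale tau 0 c = Y'.
  by rewrite gen_scaleYZ mulr0 (rmorph0 (genC R')) mul0r addr0.
have y0 : gen_scale tau 0 Y' = Y' by exact: gen_scaleY.
(* The transition matrices [P(cX) P(yX)^-1] and [Q(yX)^-1 Q(cX)], each with its inverse. *)
pose U := map_mx (dil' c) P *m map_mx (dil' Y') P'.
pose U' := map_mx (dil' Y') P *m map_mx (dil' c) P'.
pose W := map_mx (dil' Y') Q' *m map_mx (dil' c) Q.
pose W' := map_mx (dil' c) Q' *m map_mx (dil' Y') Q.
have U0 : map_mx (theta' 0) U = 1%:M by exact: theta'0_inverse.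
have U'0 : map_mx (theta' 0) U' = 1%:M by exact: theta'0_inverse.
have W0 : map_mx (theta' 0) W = 1%:M by exact: theta'0_inverse.
have W'0 : map_mx (theta' 0) W' = 1%:M by exact: theta'0_inverse.
have FUW : map_mx (dil' c) (map_mx loc0 F) =
    U *m map_mx (dil' Y') (map_mx loc0 F) *m W.
  rewrite FE !(map_mxM (dil' _)) /= !map_dil_const /U /W.
  rewrite !mulmxA -(mulmxA _ _ (map_mx _ P)) -(map_mxM (dil' Y') P') P'P.
  rewrite (map_mx1 (dil' Y')) mulmx1.
  rewrite -[in RHS](mulmxA _ (map_mx _ Q)) -(map_mxM (dil' Y') Q) QQ'.
  by rewrite (map_mx1 (dil' Y')) mulmx1.
(* One [v] serves to lift all four matrices. *)
have [v vS /(_ 1)] := for_multiplesI hS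
  (for_multiplesI hS (mx_lift1 U0) (mx_lift1 U'0))
  (for_multiplesI hS (mx_lift1 W0) (mx_lift1 W'0)).
rewrite mulr1 => -[[[A AE A0] [A' AE' A'0]] [[B BE B0] [B' BE' B'0]]].
have AA' := mx_lift_inverse (conj_mulmx1 (dil' c) (dil' Y') PP' P'P)
  U0 U'0 AE A0 AE' A'0.
have A'A := mx_lift_inverse (conj_mulmx1 (dil' Y') (dil' c) PP' P'P)
  U'0 U0 AE' A'0 AE A0.
have BB' := mx_lift_inverse (conj_mulmx1 (dil' Y') (dil' c) Q'Q QQ')
  W0 W'0 BE B0 BE' B'0.
have B'B := mx_lift_inverse (conj_mulmx1 (dil' c) (dil' Y') Q'Q QQ')
  W'0 W0 BE' B'0 BE B0.
(* The relation [FUW] for the lifts: it holds after localization, and at [z = 0] both sides are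
   [F(yX)], so [mx_kill] applies. *)
have FF : ev (fun u => map_mx (theta u) (map_mx (dil (Y + genC R v * Z)) F) =
                       map_mx (theta u) (A *m map_mx (dil Y) F *m B)).
  apply: (@mx_kill _ _ _ _ _ fs _ hS sigmaS tors n _ _
    (map_mx (dil (Y + genC R v * Z)) F) (A *m map_mx (dil Y) F *m B)).
    rewrite (map_mxM loc) (map_mxM loc) AE BE !map_loc_dil.
    rewrite (_ : gen_map f Y = Y'); last exact: gen_mapX.
    rewrite (rmorphD (gen_map f)) (rmorphM (gen_map f)) /= gen_mapC !gen_mapX.
    have := congr1 (map_mx (theta' (f v))) FUW.
    rewrite (map_mxM (theta' (f v))) (map_mxM (theta' (f v))) !map_theta_dil'.
    rewrite gen_scaleYZ gen_scaleY mul1r => e; exact: e.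
  rewrite (map_mxM (theta 0)) (map_mxM (theta 0)) A0 B0 mul1mx mulmx1.
  rewrite !map_theta_dil gen_scaleYZ gen_scaleY mulr0.
  by rewrite (rmorph0 (genC R)) mul0r addr0.
have [u uS /(_ 1)] := for_multiplesI hS FF
  (for_multiplesI hS (for_multiplesI hS AA' A'A) (for_multiplesI hS BB' B'B)).
rewrite mulr1 => -[Fu [[AA'u A'Au] [BB'u B'Bu]]].
(* Scaling [z] by [u] turns [y + v z] into [y + v u z]. *)
exists (v * u); first exact: hS.2.
exists (map_mx (theta u) A), (map_mx (theta u) B); split.
- by exists (map_mx (theta u) A').
- by exists (map_mx (theta u) B').
move: Fu; rewrite (map_mxM (theta u)) (map_mxM (theta u)) !map_theta_dil.
by rewrite gen_scaleYZ gen_scaleY.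
Qed.

End LocalDilation.

(** * From local to global *)

(* The polynomial rings of monalg need nonzero coefficient rings. *)
Lemma comPzRing_nz (R : comPzRingType) : (1 : R) <> 0 ->
  exists R0 : comNzRingType, R = R0 :> comPzRingType.
Proof.
case: R => R cR /eqP nz.
pose R1 : comPzRingType := GRing.ComPzRing.Pack cR.
pose R0 : comNzRingType :=
  HB.pack (R : Type) R1 (GRing.PzSemiRing_isNonZero.Build R1 nz).
by exists R0; rewrite /R0; case: cR @R1 nz {R0}.
Qed.

(** * Matrix equivalence: composition and base change *)

Lemma mx_equiv_refl (B : pzRingType) (r s : nat) (F : 'M[B]_(r, s)) :
  mx_equiv F F.
Proof.
have i1 k : mx_invertible (1%:M : 'M[B]_k) by exists 1%:M; rewrite mulmx1.
by exists 1%:M, 1%:M; rewrite mul1mx mulmx1.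
Qed.

Lemma mx_invertibleM (B : pzRingType) (r : nat) (P Q : 'M[B]_r) :
  mx_invertible P -> mx_invertible Q -> mx_invertible (P *m Q).
Proof.
move=> [P' [PP' P'P]] [Q' [QQ' Q'Q]]; exists (Q' *m P'); split.
  by rewrite mulmxA -(mulmxA P) QQ' mulmx1.
by rewrite mulmxA -(mulmxA Q') P'P mulmx1.
Qed.

Lemma mx_equiv_trans (B : pzRingType) (r s : nat) (F G H : 'M[B]_(r, s)) :
  mx_equiv F G -> mx_equiv G H -> mx_equiv F H.
Proof.
move=> [P [Q [iP iQ ->]]] [P' [Q' [iP' iQ' ->]]].
exists (P *m P'), (Q' *m Q); split; try exact: mx_invertibleM.
by rewrite !mulmxA.
Qed.

Lemma mx_invertible_map (A B : pzRingType) (g : {rmorphism A -> B}) (r : nat)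
    (P : 'M[A]_r) : mx_invertible P -> mx_invertible (map_mx g P).
Proof.
by move=> [P' [PP' P'P]]; exists (map_mx g P'); rewrite -!map_mxM PP' P'P map_mx1.
Qed.

Lemma mx_equiv_map (A B : pzRingType) (g : {rmorphism A -> B}) (r s : nat)
    (F G : 'M[A]_(r, s)) :
  mx_equiv F G -> mx_equiv (map_mx g F) (map_mx g G).
Proof.
move=> [P [Q [iP iQ ->]]]; exists (map_mx g P), (map_mx g Q).
by split; rewrite ?map_mxM //; apply: mx_invertible_map.
Qed.

(** * Specialization of the generic parameters *)

Lemma local_dilation_nz (n r s : nat) (R R' : comNzRingType)
    (sigma : {rmorphism R -> R}) (tau : {rmorphism R' -> R'})
    (f : {rmorphism R -> R'}) (fs : forall a, f (sigma a) = tau (f a))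
    (ids : forall a, idfun (sigma a) = sigma (idfun a)) (S : {pred R}) :
  GRing.mulr_closed S ->
  (forall u, u \in S -> exists2 v, v \in S & sigma v = u) ->
  (forall q, exists s p, s \in S /\ f s * q = f p) ->
  (forall a, f a = 0 -> exists u, u \in S /\ u * a = 0) ->
  forall F : 'M[ore n sigma]_(r, s),
  mx_equiv (map_mx (ore_subst fs 1) F) (map_mx (ore_subst fs 1) (mx_const F)) ->
  exists2 v, v \in S & forall a w,
    mx_equiv (map_mx (ore_subst ids (a + v * w)) F) (map_mx (ore_subst ids a) F).
Proof.
move=> hS sigmaS frac tors F /(generic_dilation hS sigmaS frac tors)[v vS e].
exists v => // a w.
(* At [y = a] and [z = w] the generic parameter [y + v z] becomes [a + v w]; [v] was found before
   [a] and [w] were chosen. *)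
have spec c : map_mx (ore_subst (gen_spec_shift sigma a w) 1)
    (map_mx (ore_subst (genC_shift sigma) c) F) =
    map_mx (ore_subst ids (gen_spec sigma a w c)) F.
  by apply: map_ore_subst_comp => [b|]; [apply: gen_specC | apply: mulr1].
move/(mx_equiv_map (ore_subst (gen_spec_shift sigma a w) 1)): e.
rewrite !spec (rmorphD (gen_spec _ _ _)) (rmorphM (gen_spec _ _ _)) /=.
by rewrite gen_specC !gen_specX.
Qed.

Lemma local_dilation (n r s : nat) (R R' : comPzRingType)
    (sigma : {rmorphism R -> R}) (tau : {rmorphism R' -> R'})
    (f : {rmorphism R -> R'}) (fs : forall a, f (sigma a) = tau (f a))
    (ids : forall a, idfun (sigma a) = sigma (idfun a)) (S : {pred R}) :
  (1 : R') <> 0 -> GRing.mulr_closed S ->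
  (forall u, u \in S -> exists2 v, v \in S & sigma v = u) ->
  (forall q, exists s p, s \in S /\ f s * q = f p) ->
  (forall a, f a = 0 -> exists u, u \in S /\ u * a = 0) ->
  forall F : 'M[ore n sigma]_(r, s),
  mx_equiv (map_mx (ore_subst fs 1) F) (map_mx (ore_subst fs 1) (mx_const F)) ->
  exists2 v, v \in S & forall a w,
    mx_equiv (map_mx (ore_subst ids (a + v * w)) F) (map_mx (ore_subst ids a) F).
Proof.
move=> nz'; have nz : (1 : R) <> 0.
  by move=> e; apply: nz'; rewrite -(rmorph1 f) e rmorph0.
have [R0 eR] := comPzRing_nz nz; have [R0' eR'] := comPzRing_nz nz'.
subst R R'; exact: local_dilation_nz.
Qed.

(** * Maximal ideals: existence and stability under the automorphism *)

Lemma exists_maxIdeal (R : comPzRingType) (I : {pred R}) :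
  ideal_closed I -> 1 \notin I -> exists m : maxIdeal R, {subset I <= m}.
Proof.
move=> II I1; case: (II) => I0 ID IM.
pose proper (J : {pred R}) := [/\ ideal_closed J, 1 \notin J & {subset I <= J}].
pose T := {J : R -> bool | proper J}.
pose le (J K : T) := `[< forall x, sval J x -> sval K x >].
have leP (J K : T) : reflect (forall x, sval J x -> sval K x) (le J K) by exact: asboolP.
have [] := @ZL_preorder T (exist _ I (And3 II I1 (fun _ h => h))) le.
- by move=> J; apply/leP.
- by move=> J K L /leP JK /leP KL; apply/leP => x /JK /KL.
(* The upper bound is the union of the chain together with [I], which covers the empty chain. *)
- move=> A totA; pose U : {pred R} :=
    [pred x | `[< x \in I \/ exists2 J : T, A J & x \in (sval J : {pred R}) >]].
  have AU (J : T) : A J -> {subset (sval J : {pred R}) <= U}.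
    by move=> AJ x xJ; apply/asboolP; right; exists J.
  have IU : {subset I <= U} by move=> x xI; apply/asboolP; left.
  have UI : ideal_closed U.
    split; first exact: IU.
      move=> x y /asboolP[xI|[J AJ xJ]] /asboolP[yI|[K AK yK]].
      - exact/IU/ID.
      - apply: (AU K AK); case: (svalP K) => [[_ KD _] _ IK]; exact/KD/yK/IK.
      - apply: (AU J AJ); case: (svalP J) => [[_ JD _] _ IJ]; exact/JD/IJ.
      - case: (totA J K AJ AK) => /leP JK.
          apply: (AU K AK); case: (svalP K) => [[_ KD _] _ _]; exact/KD/yK/JK.
        apply: (AU J AJ); case: (svalP J) => [[_ JD _] _ _]; exact/JD/JK.
    move=> x y /asboolP[yI|[J AJ yJ]]; first exact/IU/IM.
    by apply: (AU J AJ); case: (svalP J) => [[_ _ JM] _ _]; apply: JM.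
  have U1 : 1 \notin U.
    apply/negP => /asboolP[|[J _]]; apply/negP => //.
    by case: (svalP J).
  exists (exist _ U (And3 UI U1 IU)) => J AJ.
  by apply/leP/AU.
case=> m [mI m1 Im] mmax.
have mm : maximal_closed m.
  split=> //; first by exists 1.
  move=> J JI mJ; have [J1|J1] := boolP (1 \in J).
    by right=> a; rewrite -[a]mulr1; case: JI => _ _; apply.
  left; have pJ : proper J by split=> // x /Im /mJ.
  have /leP := mmax (exist _ J pJ) (introT (leP (exist _ m _) (exist _ J pJ)) mJ).
by [].
by exists (MaxIdeal mm).
Qed.

(** The image [sigma(m)] is an ideal by surjectivity, contains [m] by the contrapositive of the
    hypothesis, and is proper by injectivity; maximality of [m] then gives [sigma(m) = m]. *)
Lemma maxIdeal_rmorph (R : comPzRingType) (sigma : {rmorphism R -> R})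
    (sigma_bij : bijective sigma) (m : maxIdeal R) :
  (forall a, a \notin m -> sigma a \notin m) ->
  forall a, a \in m -> sigma a \in m.
Proof.
move=> sm; case: sigma_bij => g gK Kg.
case: (maxIdealP m) => -[m0 mD mM] [c cm] mmax.
pose J : {pred R} := [pred x | `[< exists2 y, y \in m & sigma y = x >]].
have JP y : y \in m -> sigma y \in J by move=> ym; apply/asboolP; exists y.
have JI : ideal_closed J.
  split; first by rewrite -(rmorph0 sigma); apply: JP.
    move=> _ _ /asboolP[y ym <-] /asboolP[z zm <-].
    by rewrite -rmorphD; apply/JP/mD.
  move=> a _ /asboolP[y ym <-].
  by rewrite -(Kg a) -rmorphM; apply/JP/mM.
have mJ : {subset m <= J}.
  move=> x xm; rewrite -(Kg x); apply: JP; apply: contraTT xm => /sm.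
  by rewrite Kg.
case: (mmax J JI mJ) => [Jm a /JP /Jm //|allJ].
have /asboolP[y ym] := allJ (sigma c).
by move/(can_inj gK) => e; rewrite -e ym in cm.
Qed.

(** * Patching the local equivalences *)

Theorem theorem3p3 (n r s : nat) (R : comPzRingType)
    (sigma : {rmorphism R -> R}) (sigma_bij : bijective sigma)
    (sigma_max : forall (m : maxIdeal R) (a : R), a \notin m -> sigma a \notin m)
    (F : 'M[ore n sigma]_(r, s)) :
  mx_equiv F (mx_const F) <->
  forall m : maxIdeal R,
    mx_equiv (map_mx (to_ore_at n (sigma_max m)) F)
             (map_mx (to_ore_at n (sigma_max m)) (mx_const F)).
Proof.
split=> [e m|locF]; first exact: mx_equiv_map.
have ids a : idfun (sigma a) = sigma (idfun a) by [].
pose D c := map_mx (ore_subst ids c) F.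
(* [D 1] is [F] and [D 0] is [F(0)]. *)
suff e : mx_equiv (D 1) (D 0).
  rewrite (mx_constE ids); suff D1 : D 1 = F by rewrite -{1}D1.
  apply/matrixP => i j; rewrite mxE; apply: oreP => k.
  by rewrite ore_substE twisted_exp1 mulr1.
pose I : {pred R} :=
  [pred c | `[< forall a w, mx_equiv (D (a + c * w)) (D a) >]].
have IP c : reflect (forall a w, mx_equiv (D (a + c * w)) (D a)) (c \in I).
  exact: asboolP.
have II : ideal_closed I.
  split.
  - by apply/IP => a w; rewrite mul0r addr0; apply: mx_equiv_refl.
  (* The step [c * w] is taken from the base point [a + b * w], which is why [I] quantifies over all
     base points. *)
  - move=> b c /IP Ib /IP Ic; apply/IP => a w.
    by rewrite mulrDl addrA; apply: mx_equiv_trans (Ic _ _) (Ib _ _).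
  - by move=> b c /IP Ic; apply/IP => a w; rewrite (mulrC b) -mulrA.
suff /IP/(_ 0 1) : 1 \in I by rewrite mulr1 add0r.
apply/negPn/negP => /(exists_maxIdeal II)[m Im].
have hS := maxIdeal_compl_closed m.
have [v vm Iv] : exists2 v, v \notin m & v \in I; last by rewrite Im in vm.
pose fs := loc_map_to_loc (maxIdeal_compl_closed m) (sigma_max m).
(* Localization is the substitution with dilation constant 1. *)
have locE (M : 'M[ore n sigma]_(r, s)) :
    map_mx (to_ore_at n (sigma_max m)) M = map_mx (ore_subst fs 1) M.
  apply/matrixP => i j; rewrite !mxE; apply: oreP => k.
  by rewrite ore_substE twisted_exp1 mulr1; apply: ore_mapE.
have nz : (1 : localization (maxIdeal_compl_closed m)) <> 0.
  rewrite -(rmorph1 (to_loc (maxIdeal_compl_closed m))).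
  move=> /to_loc_eq0[u [um]]; rewrite mulr1 => u0; move: um.
  by rewrite u0 inE /=; case: (maxIdealP m) => -[-> _ _].
(* The preimage of [u] lies outside [m], since [sigma] maps [m] into [m]. *)
have sigmaS u : u \in [predC max_pred m] ->
    exists2 v, v \in [predC max_pred m] & sigma v = u.
  case: (sigma_bij) => g gK Kg um; exists (g u) => //; move: um.
  rewrite !inE; apply: contra => /(maxIdeal_rmorph sigma_bij (sigma_max m)).
  by rewrite Kg.
have frac q : exists t p, t \in [predC max_pred m] /\
    to_loc (maxIdeal_compl_closed m) t * q = to_loc (maxIdeal_compl_closed m) p.
  elim/quotW: q => -[p [t tm]]; exists t, p; split=> //.
  by rewrite locME -pi_locM; apply: loc_eqW => /=; ring.
have tors a : to_loc (maxIdeal_compl_closed m) a = 0 ->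
    exists u, u \in [predC max_pred m] /\ u * a = 0.
  by move/to_loc_eq0.
have := locF m; rewrite !locE.
move=> /(local_dilation ids nz hS sigmaS frac tors)[v vm e].
by exists v => //; apply/IP.
Qed.
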